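(* Let $X$ be a Banach space over $\mathbb{R}$ or $\mathbb{C}$ with $n(X)=1$. If the pair $(X,X)$ has the BPBZp and $X$ has property (nu), then $X$ has the BPBp-nu.
   Context: $S_X$ is the unit sphere of a Banach space $X$, $X^*$ its topological dual, $\mathcal{L}(X,Y)$ the bounded linear operators from $X$ to $Y$, $\mathcal{L}(X)=\mathcal{L}(X,X)$. Let $\Pi(X)=\{(x,x^* )\in S_X\times S_{X^*}: x^*(x)=1\}$; for $T\in\mathcal{L}(X)$ the numerical radius is $\nu(T)=\sup\{|x^*(Tx)|:(x,x^* )\in\Pi(X)\}$, and the numerical index is $n(X)=\inf\{\nu(T):T\in\mathcal{L}(X),\ \|T\|=1\}$. BPBZp: a pair $(X,Y)$ has the BPBZp if for every $\varepsilon>0$ there exists $\eta(\varepsilon)>0$ such that whenever $T\in\mathcal{L}(X,Y)$ with $\|T\|=1$, $y_0^*\in S_{Y^*}$ and $x_0\in S_X$ satisfy $|y_0^*(Tx_0)|>1-\eta(\varepsilon)$, there exist $y_1^*\in S_{Y^*}$, $x_1\in S_X$ and $S\in\mathcal{L}(X,Y)$ with $\|S\|=|y_1^*(Sx_1)|=1$, $\|x_1-x_0\|<\varepsilon$, $\|y_1^*-y_0^*\|<\varepsilon$ and $\|S-T\|<\varepsilon$. Property (nu): $X$ has property (nu) if for every $\varepsilon>0$ there exists $\eta(\varepsilon)>0$ such that whenever $T\in S_{\mathcal{L}(X)}$, $x_0\in S_X$ and $x_0^*\in S_{X^*}$ satisfy $\operatorname{Re}x_0^*(x_0)>1-\eta(\varepsilon)$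 and $|x_0^*(Tx_0)|=1$, there exist $x_1^*\in S_{X^*}$, $x_1\in S_X$ and $S\in S_{\mathcal{L}(X)}$ such that $|x_1^*(Sx_1)|=x_1^*(x_1)=1$ and $\max\{\|x_1-x_0\|,\|x_1^*-x_0^*\|,\|S-T\|\}<\varepsilon$. BPBp-nu: $X$ has the BPBp-nu if for every $0<\varepsilon<1$ there exists $\eta(\varepsilon)>0$ such that whenever $T\in\mathcal{L}(X)$ and $(x_0,x_0^* )\in\Pi(X)$ satisfy $\nu(T)=1$ and $|x_0^*(Tx_0)|>1-\eta(\varepsilon)$, there exist $S\in\mathcal{L}(X)$ and $(x_1,x_1^* )\in\Pi(X)$ such that $\nu(S)=|x_1^*(Sx_1)|=1$, $\|S-T\|<\varepsilon$, $\|x_1-x_0\|<\varepsilon$ and $\|x_1^*-x_0^*\|<\varepsilon$. *)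

(* Defs.v *)
From Stdlib Require Import Reals.
From Coquelicot Require Import Coquelicot.

Open Scope R_scope.

Inductive scalar_field : Set := real_field | complex_field.

Definition scalars (F : scalar_field) : AbsRing :=
  match F with
  | real_field => R_AbsRing
  | complex_field => C_AbsRing
  end.

Definition re {F : scalar_field} : scalars F -> R :=
  match F return scalars F -> R with
  | real_field => fun x => x
  | complex_field => fun z => Re z
  end.

(* Coquelicot's [is_linear] is "linear and bounded", so the elements of L(U, V)
   are the functions U -> V satisfying [is_linear], and those of X^* the
   functions to the scalar field satisfying it. *)

(* ||T|| = sup { ||T x|| : ||x|| <= 1 }.  The supremum is finite whenever T is
   bounded; the projection [real] is meaningful only in that case, so [opnorm]
   must always be paired with [is_linear]. *)
Definition opnorm {K : AbsRing} {U V : NormedModule K} (T : U -> V) : R :=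
  real (Lub_Rbar (fun r => exists x : U, norm x <= 1 /\ r = norm (T x))).

Definition opdist {K : AbsRing} {U V : NormedModule K} (S T : U -> V) : R :=
  opnorm (fun x => minus (S x) (T x)).

Definition unit_vector {K : AbsRing} {X : NormedModule K} (x : X) : Prop :=
  norm x = 1.

Definition unit_operator {K : AbsRing} {U V : NormedModule K} (T : U -> V) :
    Prop :=
  is_linear T /\ opnorm T = 1.

Definition unit_functional {K : AbsRing} {X : NormedModule K} (f : X -> K) :
    Prop :=
  unit_operator (V := AbsRing_NormedModule K) f.

Definition functional_dist {K : AbsRing} {X : NormedModule K} (f g : X -> K) :
    R :=
  opdist (V := AbsRing_NormedModule K) f g.

(* The set Pi(X). *)
Definition state_pair {K : AbsRing} {X : NormedModule K} (x : X) (f : X -> K) :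
    Prop :=
  unit_vector x /\ unit_functional f /\ f x = one.

(* For X <> {0} and T bounded the set is nonempty (Hahn-Banach) and bounded, so
   the supremum is finite.  For X = {0} it is empty and the value is 0. *)
Definition numerical_radius {K : AbsRing} {X : NormedModule K} (T : X -> X) :
    R :=
  real (Lub_Rbar (fun r => exists (x : X) (f : X -> K),
    state_pair x f /\ r = abs (f (T x)))).

(* Extended-real valued: the infimum is over the empty set, hence +oo, exactly
   when X = {0}. *)
Definition numerical_index {K : AbsRing} (X : NormedModule K) : Rbar :=
  Glb_Rbar (fun r => exists T : X -> X,
    unit_operator T /\ r = numerical_radius T).

Definition BPBZp {K : AbsRing} (X Y : NormedModule K) : Prop :=
  forall eps : R, 0 < eps -> exists eta : R, 0 < eta /\
    forall (T : X -> Y) (y0s : Y -> K) (x0 : X),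
      unit_operator T -> unit_functional y0s -> unit_vector x0 ->
      abs (y0s (T x0)) > 1 - eta ->
      exists (y1s : Y -> K) (x1 : X) (S : X -> Y),
        unit_functional y1s /\ unit_vector x1 /\ unit_operator S /\
        abs (y1s (S x1)) = 1 /\
        norm (minus x1 x0) < eps /\
        functional_dist y1s y0s < eps /\
        opdist S T < eps.

Definition property_nu {F : scalar_field} (X : NormedModule (scalars F)) :
    Prop :=
  forall eps : R, 0 < eps -> exists eta : R, 0 < eta /\
    forall (T : X -> X) (x0 : X) (x0s : X -> scalars F),
      unit_operator T -> unit_vector x0 -> unit_functional x0s ->
      re (x0s x0) > 1 - eta ->
      abs (x0s (T x0)) = 1 ->
      exists (x1s : X -> scalars F) (x1 : X) (S : X -> X),
        unit_functional x1s /\ unit_vector x1 /\ unit_operator S /\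
        abs (x1s (S x1)) = 1 /\ x1s x1 = one /\
        Rmax (norm (minus x1 x0))
          (Rmax (functional_dist x1s x0s) (opdist S T)) < eps.

Definition BPBp_nu {K : AbsRing} (X : NormedModule K) : Prop :=
  forall eps : R, 0 < eps < 1 -> exists eta : R, 0 < eta /\
    forall (T : X -> X) (x0 : X) (x0s : X -> K),
      is_linear T -> state_pair x0 x0s ->
      numerical_radius T = 1 ->
      abs (x0s (T x0)) > 1 - eta ->
      exists (S : X -> X) (x1 : X) (x1s : X -> K),
        is_linear S /\ state_pair x1 x1s /\
        numerical_radius S = 1 /\ abs (x1s (S x1)) = 1 /\
        opdist S T < eps /\
        norm (minus x1 x0) < eps /\
        functional_dist x1s x0s < eps.

(* Main.v *)
Require Import Defs.
From Stdlib Require Import Reals Lra.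
From Coquelicot Require Import Coquelicot.

Open Scope R_scope.

(** Since [n(X) = 1], an operator of numerical radius 1 has norm 1.  Given such
    a [T] almost attaining its numerical radius at [(x0, x0s)], the BPBZp gives
    nearby [(S, x1, y1s)] with [S] attaining its norm at [(x1, y1s)]; this pair
    need not be a state, but [y1s x1] is close to [x0s x0 = 1], so property
    (nu) moves it to a state at which a nearby norm-one operator attains the
    value 1, which is then also its numerical radius. *)

(** * Operator norms and distances *)

Lemma is_linear_minus_fun {K : AbsRing} {U V : NormedModule K} (S T : U -> V) :
  is_linear S -> is_linear T -> is_linear (fun x => minus (S x) (T x)).
Proof.
  intros HS HT.
  apply (is_linear_comp (fun x => (S x, opp (T x)))
    (fun p : V * V => plus (fst p) (snd p))).
  - apply (is_linear_prod S (fun x => opp (T x))); [exact HS|].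
    exact (is_linear_comp T opp HT is_linear_opp).
  - exact is_linear_plus.
Qed.

(** Shows that [real] loses nothing in [opnorm]: the bound from [linear_norm] excludes [p_infty],
    and the value 0 taken at [zero] excludes [m_infty]. *)
Lemma opnorm_is_lub {K : AbsRing} {U V : NormedModule K} (T : U -> V) :
  is_linear T ->
  is_lub_Rbar (fun r => exists x : U, norm x <= 1 /\ r = norm (T x))
    (Finite (opnorm T)).
Proof.
  intros HT.
  unfold opnorm.
  set (E := fun r => exists x : U, norm x <= 1 /\ r = norm (T x)).
  pose proof (Lub_Rbar_correct E) as HE.
  destruct (linear_norm T HT) as [M [HM HTM]].
  assert (HMub : is_ub_Rbar E (Finite M)).
  { intros r [x [Hx ->]]; simpl.
    pose proof (HTM x); nra. }
  assert (H0 : E 0).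
  { exists zero; split; [rewrite norm_zero; lra|].
    rewrite linear_zero by exact HT.
    now rewrite norm_zero. }
  destruct HE as [Hub Hleast].
  pose proof (Hleast _ HMub) as Hup.
  pose proof (Hub _ H0) as Hlow.
  destruct (Lub_Rbar E) as [l| |]; simpl in *; try contradiction.
  split; assumption.
Qed.

Lemma norm_le_opnorm {K : AbsRing} {U V : NormedModule K} (T : U -> V) (x : U) :
  is_linear T -> norm x <= 1 -> norm (T x) <= opnorm T.
Proof.
  intros HT Hx.
  apply (proj1 (opnorm_is_lub T HT)).
  now exists x.
Qed.

Lemma opnorm_ge_0 {K : AbsRing} {U V : NormedModule K} (T : U -> V) :
  is_linear T -> 0 <= opnorm T.
Proof.
  intros HT.
  apply Rle_trans with (norm (T zero)); [apply norm_ge_0|].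
  apply norm_le_opnorm; [exact HT|rewrite norm_zero; lra].
Qed.

Lemma opnorm_le {K : AbsRing} {U V : NormedModule K} (T : U -> V) (c : R) :
  is_linear T -> (forall x, norm x <= 1 -> norm (T x) <= c) -> opnorm T <= c.
Proof.
  intros HT Hc.
  apply (proj2 (opnorm_is_lub T HT) (Finite c)).
  intros r [x [Hx ->]].
  exact (Hc x Hx).
Qed.

Lemma opdist_triangle {K : AbsRing} {U V : NormedModule K} (A B C : U -> V) :
  is_linear A -> is_linear B -> is_linear C ->
  opdist A C <= opdist A B + opdist B C.
Proof.
  intros HA HB HC.
  unfold opdist at 1.
  apply opnorm_le; [now apply is_linear_minus_fun|].
  intros x Hx.
  rewrite (minus_trans (B x)).
  apply Rle_trans with (1 := norm_triangle _ _).
  apply Rplus_le_compat.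
  - apply (norm_le_opnorm (fun x => minus (A x) (B x)));
      [now apply is_linear_minus_fun|exact Hx].
  - apply (norm_le_opnorm (fun x => minus (B x) (C x)));
      [now apply is_linear_minus_fun|exact Hx].
Qed.

Lemma norm_minus_triangle {K : AbsRing} {V : NormedModule K} (x y z : V) :
  norm (minus x z) <= norm (minus x y) + norm (minus y z).
Proof. rewrite (minus_trans y); apply norm_triangle. Qed.

(** * Real scalars in both fields, and rescaling *)

Definition of_real (F : scalar_field) : R -> scalars F :=
  match F return R -> scalars F with
  | real_field => fun r => r
  | complex_field => RtoC
  end.

Lemma abs_of_real (F : scalar_field) (r : R) : abs (of_real F r) = Rabs r.
Proof. destruct F; [reflexivity|exact (Cmod_R r)]. Qed.

Lemma of_real_1 (F : scalar_field) : of_real F 1 = one.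
Proof. destruct F; reflexivity. Qed.

Lemma of_real_mult (F : scalar_field) (r s : R) :
  of_real F (r * s) = mult (of_real F r) (of_real F s).
Proof. destruct F; [reflexivity|exact (RtoC_mult r s)]. Qed.

Lemma scalars_mult_comm (F : scalar_field) (a b : scalars F) :
  mult a b = mult b a.
Proof. destruct F; [exact (Rmult_comm a b)|exact (Cmult_comm a b)]. Qed.

(** The real part of [a - 1] is at most its modulus in absolute value. This turns an estimate of
    distance to 1 into the form assumed by property (nu). *)
Lemma re_ge_1_minus_abs (F : scalar_field) (a : scalars F) :
  1 - abs (minus a one) <= re a.
Proof.
  destruct F.
  - change (1 - Rabs (a - 1) <= a).
    destruct (Rcase_abs (a - 1)) as [H|H];
      [rewrite Rabs_left by exact H|rewrite Rabs_right by exact H]; lra.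
  - change (1 - Cmod (Cminus a (RtoC 1)) <= Re a).
    pose proof (Rmax_Cmod (Cminus a (RtoC 1))) as H.
    pose proof (Rmax_l (Rabs (fst (Cminus a (RtoC 1))))
      (Rabs (snd (Cminus a (RtoC 1))))) as H1.
    pose proof (Rabs_maj2 (fst (Cminus a (RtoC 1)))) as H2.
    assert (H3 : fst (Cminus a (RtoC 1)) = Re a - 1) by reflexivity.
    lra.
Qed.

Lemma scal_of_real_inv_l {F : scalar_field} {X : NormedModule (scalars F)}
    (r : R) (x : X) :
  r <> 0 -> scal (of_real F r) (scal (of_real F (/ r)) x) = x.
Proof.
  intros Hr.
  rewrite scal_assoc, <- of_real_mult, Rinv_r by exact Hr.
  rewrite of_real_1.
  apply (@scal_one (scalars F) X).
Qed.

Lemma norm_scal_of_real_le {F : scalar_field} {X : NormedModule (scalars F)}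
    (r : R) (x : X) :
  0 <= r -> norm (scal (of_real F r) x) <= r * norm x.
Proof.
  intros Hr.
  apply Rle_trans with (1 := norm_scal _ _).
  rewrite abs_of_real, Rabs_pos_eq by exact Hr.
  apply Rle_refl.
Qed.

Lemma norm_le_opnorm_mul {F : scalar_field} {U V : NormedModule (scalars F)}
    (T : U -> V) (x : U) :
  is_linear T -> norm (T x) <= opnorm T * norm x.
Proof.
  intros HT.
  destruct (norm_ge_0 x) as [Hx|Hx].
  - set (u := scal (of_real F (/ norm x)) x).
    assert (Hu : norm u <= 1).
    { apply Rle_trans with (/ norm x * norm x).
      - apply norm_scal_of_real_le.
        now apply Rlt_le, Rinv_0_lt_compat.
      - rewrite Rinv_l by lra; lra. }
    assert (Hxu : x = scal (of_real F (norm x)) u).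
    { symmetry; apply scal_of_real_inv_l; lra. }
    rewrite Hxu at 1.
    rewrite (linear_scal T HT).
    apply Rle_trans with (norm x * norm (T u)).
    + apply norm_scal_of_real_le; lra.
    + pose proof (norm_le_opnorm T u HT Hu); nra.
  (* A vector of norm 0 cannot be normalized, but boundedness gives [norm (T x) <= M * 0]. *)
  - destruct (linear_norm T HT) as [M [_ HM]].
    specialize (HM x).
    rewrite <- Hx in *; lra.
Qed.

(** * Numerical radius against operator norm *)

Lemma abs_state_le_opnorm {F : scalar_field} {X : NormedModule (scalars F)}
    (T : X -> X) (x : X) (f : X -> scalars F) :
  is_linear T -> state_pair x f -> abs (f (T x)) <= opnorm T.
Proof.
  intros HT [Hx [[Hf Hf1] _]].
  unfold unit_vector in Hx.
  pose proof (norm_le_opnorm_mul f (T x) Hf) as H1.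
  pose proof (norm_le_opnorm T x HT) as H2.
  rewrite Hf1 in H1.
  change (norm (f (T x))) with (abs (f (T x))) in H1.
  lra.
Qed.

Lemma numerical_radius_le {K : AbsRing} {X : NormedModule K}
    (T : X -> X) (c : R) :
  0 <= c -> (forall x f, state_pair x f -> abs (f (T x)) <= c) ->
  numerical_radius T <= c.
Proof.
  intros Hc0 Hc.
  unfold numerical_radius.
  match goal with |- real (Lub_Rbar ?A) <= _ => set (E := A) end.
  assert (Hub : Rbar_le (Lub_Rbar E) (Finite c)).
  { apply (proj2 (Lub_Rbar_correct E)).
    intros r [x [f [Hxf ->]]].
    exact (Hc x f Hxf). }
  (* If there are no states, the supremum is [m_infty] and [real] sends it to 0; this case uses
     [0 <= c]. *)
  destruct (Lub_Rbar E); simpl in *; lra || contradiction.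
Qed.

Lemma abs_state_le_numerical_radius {F : scalar_field}
    {X : NormedModule (scalars F)} (T : X -> X) (x : X) (f : X -> scalars F) :
  is_linear T -> state_pair x f -> abs (f (T x)) <= numerical_radius T.
Proof.
  intros HT Hxf.
  unfold numerical_radius.
  match goal with |- _ <= real (Lub_Rbar ?A) => set (E := A) end.
  (* Boundedness of [T] makes the supremum finite; otherwise [real] would return 0 for [p_infty]. *)
  assert (Hup : Rbar_le (Lub_Rbar E) (Finite (opnorm T))).
  { apply (proj2 (Lub_Rbar_correct E)).
    intros r [y [g [Hyg ->]]].
    now apply abs_state_le_opnorm. }
  assert (Hlow : Rbar_le (Finite (abs (f (T x)))) (Lub_Rbar E)).
  { apply (proj1 (Lub_Rbar_correct E)).
    now exists x, f. }
  destruct (Lub_Rbar E); simpl in *; lra || contradiction.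
Qed.

Lemma numerical_radius_ge_0 {K : AbsRing} {X : NormedModule K} (T : X -> X) :
  0 <= numerical_radius T.
Proof.
  unfold numerical_radius.
  match goal with |- 0 <= real (Lub_Rbar ?A) => set (E := A) end.
  pose proof (proj1 (Lub_Rbar_correct E)) as Hub.
  destruct (Lub_Rbar E) as [l| |] eqn:Hl; simpl; try lra.
  destruct (Rle_or_lt 0 l) as [H|H]; [exact H|exfalso].
  (* All elements of [E] are nonnegative, so a negative supremum forces [E] to be empty; its
     supremum would then be [m_infty], not the finite [l]. *)
  assert (Hempty : is_ub_Rbar E m_infty).
  { intros r Hr.
    pose proof (Hub r Hr) as Hrl; simpl in Hrl.
    destruct Hr as [x [f [_ ->]]].
    pose proof (abs_ge_0 (f (T x))); lra. }
  pose proof (proj2 (Lub_Rbar_correct E) _ Hempty) as Hm.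
  now rewrite Hl in Hm.
Qed.

Lemma numerical_radius_le_opnorm {F : scalar_field}
    {X : NormedModule (scalars F)} (T : X -> X) :
  is_linear T -> numerical_radius T <= opnorm T.
Proof.
  intros HT.
  apply numerical_radius_le; [now apply opnorm_ge_0|].
  intros x f; now apply abs_state_le_opnorm.
Qed.

(** * Normalization and numerical index 1 *)

Lemma unit_operator_normalize {F : scalar_field}
    {U V : NormedModule (scalars F)} (T : U -> V) :
  is_linear T -> 0 < opnorm T ->
  unit_operator (fun x => scal (of_real F (/ opnorm T)) (T x)).
Proof.
  intros HT Hc.
  set (c := opnorm T) in *.
  set (W := fun x => scal (of_real F (/ c)) (T x)).
  pose proof (Rinv_0_lt_compat c Hc) as Hc'.
  assert (HW : is_linear W).
  { apply (is_linear_comp T (fun y => scal (of_real F (/ c)) y) HT).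
    apply is_linear_scal_r, scalars_mult_comm. }
  split; [exact HW|].
  apply Rle_antisym.
  - apply opnorm_le; [exact HW|].
    intros x Hx.
    apply Rle_trans with (/ c * norm (T x)).
    + apply norm_scal_of_real_le; lra.
    + rewrite <- (Rinv_l c) by lra.
      apply Rmult_le_compat_l; [lra|].
      now apply norm_le_opnorm.
  (* After multiplication by [c] the goal is [c <= c * opnorm W], which follows from [T = c W] since
     [c] is the norm of [T]. *)
  - apply Rmult_le_reg_l with c; [exact Hc|].
    rewrite Rmult_1_r.
    apply opnorm_le; [exact HT|].
    intros x Hx.
    rewrite <- (scal_of_real_inv_l c (T x)) by lra.
    apply Rle_trans with (c * norm (W x)).
    + apply norm_scal_of_real_le; lra.
    + apply Rmult_le_compat_l; [lra|].
      now apply norm_le_opnorm.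
Qed.

(** For [T] of positive norm, the normalized operator [W] competes in the infimum defining the
    index, so its numerical radius is at least 1, while homogeneity bounds that radius by the
    quotient of the numerical radius of [T] by its norm. *)
Lemma opnorm_le_numerical_radius {F : scalar_field}
    {X : NormedModule (scalars F)} (T : X -> X) :
  numerical_index X = Finite 1 -> is_linear T ->
  opnorm T <= numerical_radius T.
Proof.
  intros Hindex HT.
  pose proof (numerical_radius_ge_0 T) as Hnu0.
  destruct (opnorm_ge_0 T HT) as [Hc|Hc]; [|lra].
  set (W := fun x => scal (of_real F (/ opnorm T)) (T x)).
  assert (HW1 : 1 <= numerical_radius W).
  { pose proof (proj1 (Glb_Rbar_correct
      (fun r => exists T : X -> X,
        unit_operator T /\ r = numerical_radius T))) as Hlb.
    fold (numerical_index X) in Hlb.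
    rewrite Hindex in Hlb.
    apply Hlb.
    exists W; split; [now apply unit_operator_normalize|reflexivity]. }
  pose proof (Rinv_0_lt_compat _ Hc) as Hc'.
  assert (HW2 : numerical_radius W <= / opnorm T * numerical_radius T).
  { apply numerical_radius_le; [nra|].
    intros x f Hxf.
    pose proof (proj1 (proj1 (proj2 Hxf))) as Hf.
    unfold W.
    rewrite (linear_scal f Hf).
    apply Rle_trans with (/ opnorm T * abs (f (T x))).
    - apply (@norm_scal_of_real_le F (AbsRing_NormedModule (scalars F))); lra.
    - apply Rmult_le_compat_l; [lra|].
      now apply abs_state_le_numerical_radius. }
  apply Rmult_le_reg_l with (/ opnorm T); [exact Hc'|].
  rewrite Rinv_l by lra; lra.
Qed.

Theorem theorem4p2 (F : scalar_field) (X : CompleteNormedModule (scalars F))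
    (h_index : numerical_index X = Finite 1)
    (h_BPBZp : BPBZp X X)
    (h_nu : property_nu X) :
  BPBp_nu X.
Proof.
  intros eps [Heps _].
  (* The final triple is reached in two moves, each allowed [eps / 2]. Property (nu) comes first
     because its [eta1] dictates the accuracy demanded of the BPBZp. *)
  destruct (h_nu (eps / 2)) as [eta1 [Heta1 Hnu]]; [lra|].
  (* The bound [eta1 / 2] leaves room for two errors in [y1s x1]: one from moving the functional,
     one from moving the point. *)
  set (delta := Rmin (eps / 2) (eta1 / 2)).
  assert (Hdelta : 0 < delta) by (apply Rmin_glb_lt; lra).
  assert (Hdelta_eps : delta <= eps / 2) by apply Rmin_l.
  assert (Hdelta_eta : delta <= eta1 / 2) by apply Rmin_r.
  destruct (h_BPBZp delta Hdelta) as [eta [Heta HBPB]].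
  exists eta; split; [exact Heta|].
  intros T x0 x0s HT [Hx0 [Hx0s Hx0s1]] HT1 Hnear.
  assert (HTu : unit_operator T).
  { split; [exact HT|].
    rewrite <- HT1.
    apply Rle_antisym.
    - now apply opnorm_le_numerical_radius.
    - now apply numerical_radius_le_opnorm. }
  destruct (HBPB T x0s x0 HTu Hx0s Hx0 Hnear)
    as (y1s & x1 & S1 & Hy1s & Hx1 & HS1 & Hatt1 & Hdx1 & Hdy1 & HdS1).
  pose proof (proj1 Hx0s) as Lx0s.
  pose proof (proj1 Hy1s) as Ly1s.
  assert (Hclose : re (y1s x1) > 1 - eta1).
  (* With [x0s x0] in place of 1, the error splits as [(y1s - x0s) x1 + x0s (x1 - x0)]. Both
     functionals and [x1] have norm 1, so each term is below [delta], and [2 * delta <= eta1]. *)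
  { pose proof (re_ge_1_minus_abs F (y1s x1)) as Hre.
    rewrite <- Hx0s1 in Hre.
    pose proof (norm_minus_triangle (V := AbsRing_NormedModule (scalars F))
      (y1s x1) (x0s x1) (x0s x0)) as Htri.
    assert (H1 : norm (minus (y1s x1 : AbsRing_NormedModule (scalars F))
        (x0s x1)) <= functional_dist y1s x0s).
    { apply (norm_le_opnorm (V := AbsRing_NormedModule (scalars F))
        (fun x => minus (y1s x) (x0s x))).
      - now apply (is_linear_minus_fun (V := AbsRing_NormedModule (scalars F))).
      - now apply Req_le. }
    pose proof (norm_le_opnorm_mul (V := AbsRing_NormedModule (scalars F))
      x0s (minus x1 x0) Lx0s) as H2.
    rewrite (linear_minus (V := AbsRing_NormedModule (scalars F))
      x0s x1 x0 Lx0s) in H2.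
    rewrite (proj2 Hx0s) in H2.
    change (abs (minus (y1s x1) (x0s x0)))
      with (norm (minus (y1s x1 : AbsRing_NormedModule (scalars F)) (x0s x0)))
      in Hre.
    lra. }
  destruct (Hnu S1 x1 y1s HS1 Hx1 Hy1s Hclose Hatt1)
    as (x2s & x2 & S2 & Hx2s & Hx2 & HS2 & Hatt2 & Hx2s1 & Hmax).
  pose proof (Rmax_l (norm (minus x2 x1))
    (Rmax (functional_dist x2s y1s) (opdist S2 S1))) as M1.
  pose proof (Rmax_r (norm (minus x2 x1))
    (Rmax (functional_dist x2s y1s) (opdist S2 S1))) as M2.
  pose proof (Rmax_l (functional_dist x2s y1s) (opdist S2 S1)) as M3.
  pose proof (Rmax_r (functional_dist x2s y1s) (opdist S2 S1)) as M4.
  assert (Hstate : state_pair x2 x2s) by now split.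
  destruct HS2 as [LS2 NS2].
  pose proof (proj1 HS1) as LS1.
  exists S2, x2, x2s.
  split; [exact LS2|].
  split; [exact Hstate|].
  split.
  (* The norm of [S2] bounds its numerical radius by 1, and the state [(x2, x2s)] attains this
     value. *)
  { apply Rle_antisym.
    - rewrite <- NS2; now apply numerical_radius_le_opnorm.
    - rewrite <- Hatt2; now apply abs_state_le_numerical_radius. }
  split; [exact Hatt2|].
  split.
  { pose proof (opdist_triangle S2 S1 T LS2 LS1 HT); lra. }
  split.
  { pose proof (norm_minus_triangle x2 x1 x0); lra. }
  pose proof (opdist_triangle (V := AbsRing_NormedModule (scalars F))
    x2s y1s x0s (proj1 Hx2s) Ly1s Lx0s) as H.
  unfold functional_dist in *; lra.
Qed.
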